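(* Let $\mathcal J$ and $\mathcal K$ be skew operators (with respect to $\langle\cdot,\cdot\rangle$) on the tangent bundle to $\mathcal C$, and let $\{H_j\}_{j\in\mathbb Z}$ be a sequence of functionals on $\mathcal C$. If $\mathcal J\nabla H_{k+1}=\mathcal K\nabla H_k$ for all $k$, then the $H_j$ pairwise commute, that is, $\{H_j,H_k\}_{\mathcal J}=0$ for all $j,k$.
   Context: $\mathcal C$ is the space of sequences $(q_k,r_k)^T_{k\in\mathbb Z}$ in $\mathbb C^2$ with $|q_k|,|r_k|\to0$ as $k\to\pm\infty$ (decaying rapidly enough that the sums converge, and $1-q_kr_k\neq0$). Its tangent bundle carries the symmetric bilinear form $$\langle(a,b)^T,(c,d)^T\rangle_{(q,r)^T}=-\sum_{k\in\mathbb Z}(a_kd_k+b_kc_k)(1-q_kr_k)^{-1}.$$ An operator $A$ on the tangent bundle is skew if $\langle v,Aw\rangle=-\langle Av,w\rangle$ for all tangent vectors $v,w$. The functional gradient of a functional $F$ is $\nabla_kF=-(1-q_kr_k)(\delta F/\delta r_k,\ \delta F/\delta q_k)^T$, and $\{F,G\}_{\mathcal J}=\langle\nabla F,\mathcal J\nabla G\rangle$. *)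

(* Defs.v *)
(* The complex numbers are [complex R] = R[i] over an arbitrary [R : realType];
   the alias [^o] gives them their usual topology, so that [derivable] and
   [derive1] below are about complex derivatives. *)
From mathcomp Require Import all_boot all_order all_algebra.
From mathcomp Require Import all_classical all_reals all_analysis.
From mathcomp Require Import complex.

Set Implicit Arguments.
Unset Strict Implicit.
Unset Printing Implicit Defensive.

Import Order.TTheory GRing.Theory Num.Theory.
Import numFieldNormedType.Exports.

Local Open Scope classical_set_scope.
Local Open Scope ring_scope.

Definition cplx (R : realType) := (complex R)^o.

Definition zseq (R : realType) := int -> cplx R.

(* Z is enumerated as the n%:Z together with the Negz n = - n.+1%:Z. *)
Definition cvg_at_infty (R : realType) (a : zseq R) (l : cplx R) : Prop :=
  (fun n : nat => a n%:Z) @ \oo --> l /\ (fun n : nat => a (Negz n)) @ \oo --> l.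

Definition zsummable (R : realType) (a : zseq R) : Prop :=
  cvgn [normed series (fun n : nat => a n%:Z)] /\
  cvgn [normed series (fun n : nat => a (Negz n))].

Definition zsum (R : realType) (a : zseq R) : cplx R :=
  limn (series (fun n : nat => a n%:Z)) +
  limn (series (fun n : nat => a (Negz n))).

Definition zdelta (R : realType) (k : int) : zseq R :=
  fun j => (j == k)%:R.

(* "Decaying rapidly enough that the sums converge": a complex vector space of
   null sequences in which products are absolutely summable.  It contains the
   unit sequences, so that single entries may be varied.  Examples: l^1, l^2,
   rapidly decreasing, exponentially decreasing, finitely supported sequences. *)
Record decay_class (R : realType) := DecayClass {
  decay_set :> zseq R -> Prop;
  decay_lin : forall (c : cplx R) (a b : zseq R),
    decay_set a -> decay_set b -> decay_set (fun k => c * a k + b k);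
  decay_delta : forall k, decay_set (zdelta R k);
  decay_cvg0 : forall a, decay_set a -> cvg_at_infty a 0;
  decay_summable : forall a b, decay_set a -> decay_set b ->
    zsummable (fun k => a k * b k)
}.

(* Pairs (q, r)^T for points, (a, b)^T for tangent vectors. *)
Definition zpair (R : realType) := (zseq R * zseq R)%type.

Definition phase_set (R : realType) (S : decay_class R) : set (zpair R) :=
  [set u | [/\ S u.1, S u.2 & forall k, 1 - u.1 k * u.2 k != 0]].

Definition phase (R : realType) (S : decay_class R) : Type :=
  set_type (phase_set S).

(* The phase space is open in S x S along each coordinate direction, and its
   tangent space at every point is S x S. *)
Definition tangent (R : realType) (S : decay_class R) : set (zpair R) :=
  [set v | S v.1 /\ S v.2].

Definition weight (R : realType) (u : zpair R) (k : int) : cplx R :=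
  1 - u.1 k * u.2 k.

(* The sum converges absolutely on tangent vectors: products are absolutely
   summable, and the inverse weights are bounded since q_k r_k tends to 0. *)
Definition tangent_form (R : realType) (S : decay_class R) (p : phase S)
    (v w : zpair R) : cplx R :=
  - zsum (fun k => (v.1 k * w.2 k + v.2 k * w.1 k) * (weight (val p) k)^-1).

Definition zpair_comb (R : realType) (c : cplx R) (v w : zpair R) : zpair R :=
  (fun k => c * v.1 k + w.1 k, fun k => c * v.2 k + w.2 k).

(* Fibrewise linear maps preserving each tangent space; values of A p on pairs
   that are not tangent vectors are irrelevant. *)
Definition tangent_operator (R : realType) (S : decay_class R)
    (A : phase S -> zpair R -> zpair R) : Prop :=
  forall p : phase S,
    (forall v, tangent S v -> tangent S (A p v)) /\
    (forall c v w, tangent S v -> tangent S w ->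
       A p (zpair_comb c v w) = zpair_comb c (A p v) (A p w)).

Definition skew_operator (R : realType) (S : decay_class R)
    (A : phase S -> zpair R -> zpair R) : Prop :=
  forall (p : phase S) (v w : zpair R), tangent S v -> tangent S w ->
    tangent_form p v (A p w) = - tangent_form p (A p v) w.

(* t |-> F (p + t v).  The function F is extended by 0 outside the phase space;
   this does not affect derivatives at t = 0 when v has a single nonzero entry,
   as the condition 1 - q_k r_k != 0 is then open in t. *)
Definition along (R : realType) (S : decay_class R) (F : phase S -> cplx R)
    (p : phase S) (v : zpair R) : cplx R -> cplx R :=
  fun t => 'valL_ (0 : cplx R) F (zpair_comb t v (val p)).

Definition dir_q (R : realType) (k : int) : zpair R := (zdelta R k, fun=> 0).
Definition dir_r (R : realType) (k : int) : zpair R := (fun=> 0, zdelta R k).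

(* On sequences, the functional derivatives delta F / delta q_k and
   delta F / delta r_k are complex partial derivatives. *)
Definition dq (R : realType) (S : decay_class R) (F : phase S -> cplx R)
    (p : phase S) : zseq R := fun k => derive1 (along F p (dir_q R k)) 0.
Definition dr (R : realType) (S : decay_class R) (F : phase S -> cplx R)
    (p : phase S) : zseq R := fun k => derive1 (along F p (dir_r R k)) 0.

(* The sign, the swap and the weight make this the gradient for tangent_form:
   <grad F, (a, b)^T> = sum_k (dF/dq_k a_k + dF/dr_k b_k). *)
Definition grad (R : realType) (S : decay_class R) (F : phase S -> cplx R)
    (p : phase S) : zpair R :=
  (fun k => - weight (val p) k * dr F p k,
   fun k => - weight (val p) k * dq F p k).

(* The functional derivatives exist, and the gradient is a section of the
   tangent bundle. *)
Definition functional (R : realType) (S : decay_class R)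
    (F : phase S -> cplx R) : Prop :=
  forall p : phase S,
    (forall k, derivable (along F p (dir_q R k)) 0 1 /\
               derivable (along F p (dir_r R k)) 0 1) /\
    tangent S (grad F p).

Definition bracket (R : realType) (S : decay_class R)
    (J : phase S -> zpair R -> zpair R) (F G : phase S -> cplx R)
    (p : phase S) : cplx R :=
  tangent_form p (grad F p) (J p (grad G p)).

(* Main.v *)
Require Import Defs.
From mathcomp Require Import all_boot all_order all_algebra.
From mathcomp Require Import all_classical all_reals all_analysis.
From mathcomp Require Import complex.

(** This is the Lenard-Magri argument. Skewness of [J] and symmetry of the form
    make the matrix [b j k = {H_j, H_k}_J] antisymmetric. The recursion trades
    [J grad H_{k+1}] for [K grad H_k]; moving [K] to the other side by its own
    skewness and trading back, with the two signs cancelling, gives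
    [b j (k + 1) = b (j + 1) k] ([bracket_shift]). Transferring [n] units of
    index from one entry to the other thus turns [b j (j + n)] into
    [b (j + n) j], which is its opposite; as [2] is invertible in the complex
    numbers, both vanish ([antisym_shift_eq0]). *)

Import Order.TTheory GRing.Theory Num.Theory.
Local Open Scope ring_scope.

Lemma antisym_shift_eq0 (V : numDomainType) (b : int -> int -> V)
    (b_anti : forall j k, b j k = - b k j)
    (b_shift : forall j k, b j (k + 1) = b (j + 1) k) :
  forall j k, b j k = 0.
Proof.
have b_shiftn (n : nat) j k : b j (k + n%:Z) = b (j + n%:Z) k.
  elim: n j k => [|n IHn] j k; first by rewrite !addr0.
  by rewrite -addn1 PoszD !addrA b_shift IHn addrAC.
have b_ge (j : int) (n : nat) : b j (j + n%:Z) = 0.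
  by apply/eqP; rewrite -eqNr -b_anti -(b_shiftn n j j).
move=> j k; wlog le_jk : j k / j <= k => [b_le|].
  have [/b_le //|/ltW /b_le b_kj] := leP j k.
  by rewrite b_anti b_kj oppr0.
by rewrite -(subrKC j k) -(gez0_abs (_ : 0 <= k - j)) ?subr_ge0.
Qed.

Lemma tangent_form_sym (R : realType) (S : decay_class R) (p : phase S)
    (v w : zpair R) :
  tangent_form p v w = tangent_form p w v.
Proof.
rewrite /tangent_form; congr (- zsum _); apply/funext => k.
by rewrite addrC [v.2 k * _]mulrC [v.1 k * _]mulrC.
Qed.

Lemma bracket_antisym (R : realType) (S : decay_class R)
    (J : phase S -> zpair R -> zpair R) (F G : phase S -> cplx R)
    (J_skew : skew_operator J) (F_fun : functional F) (G_fun : functional G)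
    (p : phase S) :
  bracket J F G p = - bracket J G F p.
Proof.
have [[_ tF] [_ tG]] := (F_fun p, G_fun p).
rewrite /bracket.
(* With opaque vectors, comparing two gradients fails without unfolding
   partial derivatives. *)
move: (grad F p) (grad G p) tF tG => v w tv tw.
by rewrite (J_skew p v w tv tw) (tangent_form_sym _ S p (J p v)).
Qed.

(** Both brackets equal [<grad F, K grad G>]: the one on the left directly, the
    one on the right because the signs from the skewness of [K] and of [J]
    cancel. *)
Lemma bracket_shift (R : realType) (S : decay_class R)
    (J K : phase S -> zpair R -> zpair R) (F F' G G' : phase S -> cplx R)
    (J_skew : skew_operator J) (K_skew : skew_operator K)
    (F_fun : functional F) (F'_fun : functional F') (G_fun : functional G)
    (p : phase S)
    (recF : J p (grad F' p) = K p (grad F p))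
    (recG : J p (grad G' p) = K p (grad G p)) :
  bracket J F G' p = bracket J F' G p.
Proof.
have [[_ tF] [_ tF'] [_ tG]] := And3 (F_fun p) (F'_fun p) (G_fun p).
rewrite /bracket.
move: (grad F p) (grad F' p) (grad G p) (grad G' p) tF tF' tG recF recG
  => v v' w w' tv tv' tw recv recw.
by rewrite recw (K_skew p v w tv tw) (J_skew p v' w tv' tw) recv.
Qed.

Theorem corollary5 (R : realType) (S : decay_class R)
    (J K : phase S -> zpair R -> zpair R)
    (J_op : tangent_operator J) (K_op : tangent_operator K)
    (J_skew : skew_operator J) (K_skew : skew_operator K)
    (H : int -> phase S -> cplx R)
    (H_functional : forall j : int, functional (H j))
    (recursion : forall (k : int) (p : phase S),
       J p (grad (H (k + 1)) p) = K p (grad (H k) p)) :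
  forall (j k : int) (p : phase S), bracket J (H j) (H k) p = 0.
Proof.
move=> j k p.
apply: (@antisym_shift_eq0 (complex R) (fun j k => bracket J (H j) (H k) p)).
  by move=> i l; exact: bracket_antisym.
by move=> i l; exact: (@bracket_shift _ _ J K).
Qed.
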